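(* Let $\tau\in(0,1)$, let $\Delta^{\max}:=\max_{\mathbf{x}\in\mathbf{X}}\|\mathbf{A}\mathbf{x}-\mathbf{b}\|$ be the maximal constraint residual over $\mathbf{X}$, and let the proximal ADMM described in the context start with any given initial dual variable $\boldsymbol{\lambda}^0$. Then $\|\boldsymbol{\lambda}^k\|$ is bounded: for all $k$, $$\|\boldsymbol{\lambda}^k\|\le\|\boldsymbol{\lambda}^0\|+\tau^{-1}\rho\,\Delta^{\max},$$ and also $$\|\boldsymbol{\lambda}^k\|^2\le 2\|\boldsymbol{\lambda}^0\|^2+2\tau^{-2}\rho^2(\Delta^{\max})^2 .$$
   Context: Problem: minimize $F(\mathbf{x})=g(\mathbf{x})+\sum_{i=1}^N f_i(\mathbf{x}_i)$ over $\mathbf{x}=(\mathbf{x}_i)_{i=1}^N\in\mathbb{R}^n$, $\mathbf{x}_i\in\mathbb{R}^{n_i}$, $n=\sum_i n_i$, subject to $\sum_{i=1}^N\mathbf{A}_i\mathbf{x}_i=\mathbf{b}$ and $\mathbf{x}_i\in\mathbf{X}_i$, $i=1,\dots,N$. Here $f_i:\mathbb{R}^{n_i}\to\mathbb{R}$ and $g:\mathbb{R}^n\to\mathbb{R}$ are continuously differentiable, possibly nonconvex; $\mathbf{A}_i\in\mathbb{R}^{m\times n_i}$, $\mathbf{A}=(\mathbf{A}_1,\dots,\mathbf{A}_N)\in\mathbb{R}^{m\times n}$, $\mathbf{b}\in\mathbb{R}^m$; each $\mathbf{X}_i\subseteq\mathbb{R}^{n_i}$ is a compact convex set. Write $f(\mathbf{x})=\sum_i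 f_i(\mathbf{x}_i)$ and $\mathbf{X}=\mathbf{X}_1\times\cdots\times\mathbf{X}_N$. Standing assumptions: (A1) $\nabla f$ and $\nabla g$ are Lipschitz continuous on $\mathbf{X}$ with moduli $L_f$ and $L_g$; (A2) $f$ and $g$ are bounded below on $\mathbf{X}$. Proximal ADMM: parameters are a discount factor $\tau$, a penalty parameter $\rho>0$, a proximal parameter $\beta$, and real matrices $\mathbf{B}_i$ with $n_i$ columns. Starting from initial $\mathbf{x}^0\in\mathbb{R}^n$, $\boldsymbol{\lambda}^0\in\mathbb{R}^m$, for $k=0,1,2,\dots$ compute, for each $i$ in parallel, $$\mathbf{x}_i^{k+1}\in\arg\min_{\mathbf{x}_i\in\mathbf{X}_i}\Big\{\langle\nabla_i g(\mathbf{x}^k),\mathbf{x}_i-\mathbf{x}_i^k\rangle+f_i(\mathbf{x}_i)+\langle\boldsymbol{\lambda}^k,\mathbf{A}_i\mathbf{x}_i\rangle+\tfrac{\rho}{2}\big\|\mathbf{A}_i\mathbf{x}_i+\sum_{j\ne i}\mathbf{A}_j\mathbf{x}_j^k-\mathbf{b}\big\|^2+\tfrac{\beta}{2}\|\mathbf{B}_i(\mathbf{x}_i-\mathbf{x}_i^k)\|^2\Big\},$$ where $\nabla_i g$ is the partial gradient with respect to $\mathbf{x}_i$, and then $$\boldsymbol{\lambda}^{k+1}=(1-\tau)\boldsymbol{\lambda}^k+\rho(\mathbf{A}\mathbf{x}^{k+1}-\mathbf{b}).$$ $\|\cdot\|$ is the Euclidean norm. *)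

(* Defs.v *)
From HB Require Import structures.
From mathcomp Require Import all_boot all_order all_algebra.
From mathcomp Require Import all_classical all_reals all_analysis.
Set Implicit Arguments.
Unset Strict Implicit.
Unset Printing Implicit Defensive.
Import Order.TTheory GRing.Theory Num.Theory.
Import numFieldNormedType.Exports.
Local Open Scope classical_set_scope.
Local Open Scope ring_scope.

(* The norm `|v| of the library on 'cV[R]_d is the sup norm, so the Euclidean
   inner product and norm are introduced here; both norms induce the library's
   topology, which is the one used for compactness and continuity. *)
Definition dotv (R : realType) (d : nat) (u v : 'cV[R]_d) : R :=
  \sum_(i < d) u i 0 * v i 0.

Definition norm2 (R : realType) (d : nat) (v : 'cV[R]_d) : R :=
  Num.sqrt (dotv v v).

Definition grad (R : realType) (d : nat) (h : 'cV[R]_d -> R) (x : 'cV[R]_d) :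
    'cV[R]_d :=
  \col_(j < d) 'D_(delta_mx j 0) h x.

Definition continuously_differentiable (R : realType) (d : nat)
    (h : 'cV[R]_d -> R) : Prop :=
  (forall x, differentiable h x) /\ continuous (grad h).

Definition lipschitz_grad_on (R : realType) (d : nat) (L : R)
    (S : set 'cV[R]_d) (h : 'cV[R]_d -> R) : Prop :=
  forall x y, S x -> S y -> norm2 (grad h x - grad h y) <= L * norm2 (x - y).

Definition argmin (R : realType) (T : Type) (S : set T) (h : T -> R) : set T :=
  [set y | S y /\ forall z, S z -> h y <= h z].

(* The greatest element of S; the default value 0 is only taken when S has
   none. *)
Definition set_max (R : realType) (S : set R) : R :=
  xget 0 (S `&` ubound S).

(* A point of R^n, n = n_1 + ... + n_N, is a column vector x of height
   \sum_i n_ i, and its i-th block is submxcol x i. *)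

Definition block_set (R : realType) (N : nat) (n_ : 'I_N -> nat)
    (X_ : forall i, set 'cV[R]_(n_ i)) : set 'cV[R]_(\sum_i n_ i) :=
  [set x | forall i, X_ i (submxcol x i)].

Definition block_sum (R : realType) (N : nat) (n_ : 'I_N -> nat)
    (f_ : forall i, 'cV[R]_(n_ i) -> R) (x : 'cV[R]_(\sum_i n_ i)) : R :=
  \sum_(i < N) f_ i (submxcol x i).

Definition residual (R : realType) (N m : nat) (n_ : 'I_N -> nat)
    (A_ : forall i, 'M[R]_(m, n_ i)) (b : 'cV[R]_m)
    (x : 'cV[R]_(\sum_i n_ i)) : 'cV[R]_m :=
  (\mxrow_i A_ i) *m x - b.

Definition max_residual (R : realType) (N m : nat) (n_ : 'I_N -> nat)
    (A_ : forall i, 'M[R]_(m, n_ i)) (b : 'cV[R]_m)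
    (X_ : forall i, set 'cV[R]_(n_ i)) : R :=
  set_max [set norm2 (residual A_ b x) | x in block_set X_].

Definition subproblem (R : realType) (N m : nat) (n_ q_ : 'I_N -> nat)
    (f_ : forall i, 'cV[R]_(n_ i) -> R) (g : 'cV[R]_(\sum_i n_ i) -> R)
    (A_ : forall i, 'M[R]_(m, n_ i)) (b : 'cV[R]_m)
    (B_ : forall i, 'M[R]_(q_ i, n_ i)) (rho beta : R)
    (x : 'cV[R]_(\sum_i n_ i)) (lambda : 'cV[R]_m)
    (i : 'I_N) (y : 'cV[R]_(n_ i)) : R :=
  dotv (submxcol (grad g x) i) (y - submxcol x i) + f_ i y
  + dotv lambda (A_ i *m y)
  + rho / 2 *
      norm2 (A_ i *m y + \sum_(j < N | j != i) A_ j *m submxcol x j - b) ^+ 2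
  + beta / 2 * norm2 (B_ i *m (y - submxcol x i)) ^+ 2.

(* The subproblems may have several minimizers, so the method is a predicate on
   pairs of sequences: it holds of every possible run. The initial points x 0
   and lambda 0 are unconstrained. *)
Definition proximal_ADMM (R : realType) (N m : nat) (n_ q_ : 'I_N -> nat)
    (f_ : forall i, 'cV[R]_(n_ i) -> R) (g : 'cV[R]_(\sum_i n_ i) -> R)
    (A_ : forall i, 'M[R]_(m, n_ i)) (b : 'cV[R]_m)
    (X_ : forall i, set 'cV[R]_(n_ i))
    (B_ : forall i, 'M[R]_(q_ i, n_ i)) (tau rho beta : R)
    (x : nat -> 'cV[R]_(\sum_i n_ i)) (lambda : nat -> 'cV[R]_m) : Prop :=
  forall k : nat,
    (forall i : 'I_N,
      argmin (X_ i) (subproblem f_ g A_ b B_ rho beta (x k) (lambda k) (i := i))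
        (submxcol (x k.+1) i)) /\
    lambda k.+1 = (1 - tau) *: lambda k + rho *: residual A_ b (x k.+1).

(* Under the standing assumptions the maximal residual is attained, so the
   default value of set_max plays no role as soon as X is nonempty. *)
Lemma max_residual_attained (R : realType) (N m : nat) (n_ : 'I_N -> nat)
    (A_ : forall i, 'M[R]_(m, n_ i)) (b : 'cV[R]_m)
    (X_ : forall i, set 'cV[R]_(n_ i)) :
  (forall i, compact (X_ i)) -> block_set X_ !=set0 ->
  (exists2 x, block_set X_ x & norm2 (residual A_ b x) = max_residual A_ b X_)
  /\ forall x, block_set X_ x -> norm2 (residual A_ b x) <= max_residual A_ b X_.
Proof.
move=> cX [x0 Xx0].
have := tychonoff cX.
set K := (K in compact K -> _) => cK.
pose F (h : prod_topology (fun i => 'cV[R]_(n_ i))) :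
  'cV[R]_(\sum_i n_ i) := \mxcol_i h i.
have csum (T : topologicalType) k (u : 'I_k -> T -> R) :
    (forall i, continuous (u i)) -> continuous (fun t => \sum_(i < k) u i t).
  by move=> cu; apply: continuous_big => //; exact: add_continuous.
have cmul (T : topologicalType) (u v : T -> R) :
    continuous u -> continuous v -> continuous (fun t => u t * v t).
  by move=> cu cv t; apply: cvgM; [exact: cu|exact: cv].
have csub (T : topologicalType) (u : T -> R) (c : R) :
    continuous u -> continuous (fun t => u t - c).
  by move=> cu t; apply: cvgB; [exact: cu|exact: cvg_cst].
have cF : continuous (fun h => norm2 (residual A_ b (F h))).
  move=> h; rewrite /norm2 /dotv.
  apply: (@continuous_comp _ _ _ (fun h => \sum_(i < m)
    residual A_ b (F h) i 0 * residual A_ b (F h) i 0) Num.sqrt);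
    last exact: sqrt_continuous.
  move: h; apply: (csum) => i.
  suff c : continuous (fun h => residual A_ b (F h) i 0) by exact: cmul.
  have -> : (fun h => residual A_ b (F h) i 0) = (fun h =>
      \sum_j (\mxrow_i A_ i) i j * h (tagnat.sig1 j) (tagnat.sig2 j) 0 - b i 0).
    apply/funext => h'; rewrite /residual !mxE; congr (_ - _).
    by apply: eq_bigr => j _; rewrite [F h' j 0]mxE.
  apply: (csub); apply: (csum) => j.
  apply: (cmul _ (fun=> _)); first exact: cst_continuous.
  move=> h; apply: (@continuous_comp _ _ _
    (fun h : prod_topology (fun i => 'cV[R]_(n_ i)) => h (tagnat.sig1 j))
    (fun M : 'cV[R]__ => M (tagnat.sig2 j) 0)); last exact: coord_continuous.
  exact: proj_continuous.
have K0 : K !=set0 by exists (fun i => submxcol x0 i); exact: Xx0.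
have [h /set_mem Kh hmax] := @compact_EVT_max
  (prod_topology (fun i => 'cV[R]_(n_ i))) _ _ _ K0 cK (continuous_subspaceT cF).
pose S := [set norm2 (residual A_ b x) | x in block_set X_].
have : (S `&` ubound S) (norm2 (residual A_ b (F h))).
  split.
    by exists (F h) => // i; rewrite /F mxcolK; exact: Kh.
  move=> _ [x Xx <-].
  have /hmax : (fun i => submxcol x i) \in K by rewrite inE; exact: Xx.
  by rewrite {1}/F submxcolK.
move=> /xgetI-/(_ 0) [[x Xx xE] ub]; split; first by exists x.
by move=> y Xy; apply: ub; exists y.
Qed.

(* Main.v *)
Require Import Defs.
From mathcomp Require Import all_boot all_order all_algebra.
From mathcomp Require Import all_classical all_reals all_analysis.
From mathcomp Require Import ring lra.
Import Order.TTheory GRing.Theory Num.Theory.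
Import numFieldNormedType.Exports.
Local Open Scope classical_set_scope.
Local Open Scope ring_scope.

(* The dual update contracts lambda by 1 - tau and adds a vector of norm at most
   rho * Delta, since every iterate x^(k+1) lies in X; the fixed point of
   t |-> (1 - tau) t + rho * Delta is rho * Delta / tau. *)

Lemma dotvDl (R : realType) (d : nat) (u v w : 'cV[R]_d) :
  dotv (u + v) w = dotv u w + dotv v w.
Proof. by rewrite /dotv -big_split; apply: eq_bigr => i _; rewrite mxE mulrDl. Qed.

Lemma dotvZl (R : realType) (d : nat) (a : R) (u v : 'cV[R]_d) :
  dotv (a *: u) v = a * dotv u v.
Proof. by rewrite /dotv mulr_sumr; apply: eq_bigr => i _; rewrite mxE mulrA. Qed.

Lemma dotvC (R : realType) (d : nat) (u v : 'cV[R]_d) : dotv u v = dotv v u.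
Proof. by apply: eq_bigr => i _; rewrite mulrC. Qed.

Lemma dotvDr (R : realType) (d : nat) (u v w : 'cV[R]_d) :
  dotv u (v + w) = dotv u v + dotv u w.
Proof. by rewrite dotvC dotvDl !(dotvC _ _ u). Qed.

Lemma dotvZr (R : realType) (d : nat) (a : R) (u v : 'cV[R]_d) :
  dotv u (a *: v) = a * dotv u v.
Proof. by rewrite dotvC dotvZl dotvC. Qed.

Lemma dotv_ge0 (R : realType) (d : nat) (u : 'cV[R]_d) : 0 <= dotv u u.
Proof. by apply: sumr_ge0 => i _; rewrite -expr2 sqr_ge0. Qed.

Lemma dotv_eq0 (R : realType) (d : nat) (u : 'cV[R]_d) : dotv u u = 0 -> u = 0.
Proof.
move=> u0; apply/colP => i; rewrite mxE; apply/eqP.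
have /eqP := psumr_eq0P (fun i _ => sqr_ge0 (u i 0)) u0 (erefl : xpredT i).
by rewrite sqrf_eq0.
Qed.

Lemma norm2_ge0 (R : realType) (d : nat) (u : 'cV[R]_d) : 0 <= norm2 u.
Proof. exact: sqrtr_ge0. Qed.

Lemma sqr_norm2 (R : realType) (d : nat) (u : 'cV[R]_d) :
  norm2 u ^+ 2 = dotv u u.
Proof. exact/sqr_sqrtr/dotv_ge0. Qed.

Lemma norm2Z (R : realType) (d : nat) (a : R) (u : 'cV[R]_d) :
  norm2 (a *: u) = `|a| * norm2 u.
Proof.
by rewrite /norm2 dotvZl dotvZr mulrA -expr2 sqrtrM ?sqr_ge0 // sqrtr_sqr.
Qed.

(** Cauchy-Schwarz, from the nonnegative squared length of [(v.v) u - (u.v) v], which expands to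
    [(v.v) ((u.u) (v.v) - (u.v)^2)]. *)
Lemma dotv_le_norm2 (R : realType) (d : nat) (u v : 'cV[R]_d) :
  dotv u v <= norm2 u * norm2 v.
Proof.
have [/dotv_eq0 ->|v0] := eqVneq (dotv v v) 0.
  (* Writing the zero vector as [0 *: 0] lets homogeneity make both sides vanish. *)
  by rewrite -(scale0r 0) dotvZr norm2Z normr0 !mul0r mulr0.
have vp : 0 < dotv v v by rewrite lt_neqAle eq_sym v0 dotv_ge0.
have := dotv_ge0 _ _ (dotv v v *: u + (- dotv u v) *: v).
rewrite !(dotvDl, dotvDr, dotvZl, dotvZr) (dotvC _ _ v u) => h.
(* [dotv u v] may be negative; passing to its absolute value makes both sides nonnegative, so that
   squares can be compared. *)
apply: le_trans (ler_norm _) _.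
rewrite -ler_sqr ?nnegrE ?mulr_ge0 ?norm2_ge0 // real_normK ?num_real //.
(* Multiplying the difference of squares by [dotv v v > 0] turns it into the expression in [h]. *)
rewrite exprMn !sqr_norm2 -subr_ge0 -(pmulr_rge0 _ vp).
by apply: le_trans h _; rewrite le_eqVlt; apply/orP; left; apply/eqP; ring.
Qed.

(** After squaring, the two sides differ only in the cross term, which Cauchy-Schwarz controls. *)
Lemma ler_norm2D (R : realType) (d : nat) (u v : 'cV[R]_d) :
  norm2 (u + v) <= norm2 u + norm2 v.
Proof.
rewrite -ler_sqr ?nnegrE ?addr_ge0 ?norm2_ge0 //.
rewrite sqr_norm2 sqrrD !sqr_norm2 !(dotvDl, dotvDr) (dotvC _ _ v u).
by have := dotv_le_norm2 _ _ u v; lra.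
Qed.

Theorem proposition4 (R : realType) (N m : nat) (n_ q_ : 'I_N -> nat)
  (f_ : forall i, 'cV[R]_(n_ i) -> R) (g : 'cV[R]_(\sum_i n_ i) -> R)
  (A_ : forall i, 'M[R]_(m, n_ i)) (b : 'cV[R]_m)
  (X_ : forall i, set 'cV[R]_(n_ i))
  (f_C1 : forall i, continuously_differentiable (f_ i))
  (g_C1 : continuously_differentiable g)
  (X_compact : forall i, compact (X_ i))
  (X_convex : forall i, convex_set (X_ i))
  (Lf Lg : R)
  (f_lipschitz : lipschitz_grad_on Lf (block_set X_) (block_sum f_))
  (g_lipschitz : lipschitz_grad_on Lg (block_set X_) g)
  (f_bounded_below : has_lbound (block_sum f_ @` block_set X_))
  (g_bounded_below : has_lbound (g @` block_set X_))
  (B_ : forall i, 'M[R]_(q_ i, n_ i)) (tau rho beta : R)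
  (tau_gt0 : 0 < tau) (tau_lt1 : tau < 1) (rho_gt0 : 0 < rho)
  (x : nat -> 'cV[R]_(\sum_i n_ i)) (lambda : nat -> 'cV[R]_m)
  (run : proximal_ADMM f_ g A_ b X_ B_ tau rho beta x lambda) :
  forall k : nat,
    norm2 (lambda k) <=
      norm2 (lambda 0%N) + tau^-1 * rho * max_residual A_ b X_ /\
    norm2 (lambda k) ^+ 2 <=
      2 * norm2 (lambda 0%N) ^+ 2 +
      2 * tau ^- 2 * rho ^+ 2 * max_residual A_ b X_ ^+ 2.
Proof.
(* Feasibility starts at index 1, since [x 0] is arbitrary. The dual update only uses [x k.+1], and
   [x 1] witnesses that the feasible set is nonempty, so the maximal residual is attained. *)
have Xx k : block_set X_ (x k.+1) by move=> i; have [/(_ i) []] := run k.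
have [_ resP] := max_residual_attained A_ b X_compact (ex_intro _ _ (Xx 0%N)).
set D := max_residual A_ b X_ in resP *.
have D0 : 0 <= D := le_trans (norm2_ge0 _ _ _) (resP _ (Xx 0%N)).
have K0 : 0 <= tau^-1 * rho * D.
  by rewrite !mulr_ge0 ?invr_ge0 // ltW.
have bound k : norm2 (lambda k) <= norm2 (lambda 0%N) + tau^-1 * rho * D.
  elim: k => [|k IHk]; first by rewrite lerDl.
  have [_ ->] := run k; apply: le_trans (ler_norm2D _ _ _ _) _.
  rewrite !norm2Z (gtr0_norm rho_gt0) gtr0_norm ?subr_gt0 //.
  have rD : rho * norm2 (residual A_ b (x k.+1)) <= rho * D.
    by rewrite ler_pM2l //; exact: resP.
  have lD : (1 - tau) * norm2 (lambda k) <=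
      (1 - tau) * (norm2 (lambda 0%N) + tau^-1 * rho * D).
    by rewrite ler_pM2l ?subr_gt0.
  have l0 : 0 <= tau * norm2 (lambda 0%N) by rewrite mulr_ge0 ?norm2_ge0 // ltW.
  (* With [K = tau^-1 * rho * D], the bound becomes [(1 - tau) (|lambda 0| + K) + tau K = |lambda 0|
     + K - tau |lambda 0|], and [l0] allows dropping the last term. *)
  have fixD : tau * (tau^-1 * rho * D) = rho * D by field; rewrite gt_eqF.
  lra.
move=> k; split=> //.
have -> : 2 * tau ^- 2 * rho ^+ 2 * D ^+ 2 = 2 * (tau^-1 * rho * D) ^+ 2.
  by rewrite !exprMn exprVn !mulrA.
apply: (@le_trans _ _ ((norm2 (lambda 0%N) + tau^-1 * rho * D) ^+ 2)).
  by rewrite ler_sqr ?nnegrE ?addr_ge0 ?norm2_ge0.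
(* [(a + c)^2 <= 2 a^2 + 2 c^2], because the gap is exactly [(a - c)^2]. *)
by have := sqr_ge0 (norm2 (lambda 0%N) - tau^-1 * rho * D); lra.
Qed.
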